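(* Let $B>0$ and let $A_B$ be chosen so that $\mathbf{E}_\infty N_{A_B}=B$, where $N_{A_B}=\min\{n\ge 1: R_n\ge A_B\}$ is the Shiryaev-Roberts stopping time with $$R_n=\sum_{k=1}^n\prod_{i=k}^n\frac{f_1(X_i)}{f_0(X_i)}.$$ Then the Shiryaev-Roberts procedure $N_{A_B}$ minimizes $$\sum_{k=1}^\infty \mathbf{E}_k(N-k)^+$$ over all stopping times $N$ that satisfy $\mathbf{E}_\infty N\ge B$; i.e., $$\inf_{N\in\boldsymbol{\Delta}_B}\ \sum_{k=1}^\infty \mathbf{E}_k(N-k)^+=\sum_{k=1}^\infty \mathbf{E}_k(N_{A_B}-k)^+\quad\text{for every } B>0,$$ where $\boldsymbol{\Delta}_B=\{N:\mathbf{E}_\infty N\ge B\}$.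
   Context: Changepoint setting: $X_1,X_2,\dots$ are independent observations, and $\nu$ denotes the serial number of the first post-change observation. For $1\le k<\infty$, $\mathbf{P}_k$ and $\mathbf{E}_k$ denote probability and expectation when $\nu=k$: $X_1,\dots,X_{k-1}$ each have density $f_0$ and $X_k,X_{k+1},\dots$ each have density $f_1$, all independent. $\mathbf{P}_\infty$ and $\mathbf{E}_\infty$ correspond to $\nu=\infty$ (no change): all $X_i$ are iid with density $f_0$. The densities $f_0$ and $f_1$ (with respect to a common reference measure) are known. A detection procedure is identified with a stopping time $N$ on $X_1,X_2,\dots$, i.e. $\{N\le n\}\in\mathcal{F}_n$, where $\mathcal{F}_n=\sigma(X_1,\dots,X_n)$. The average run length to false alarm of $N$ is $\mathrm{ARL2FA}(N)=\mathbf{E}_\infty N$. Here $x^+=\max(x,0)$. *)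

(* Defs.v *)
From HB Require Import structures.
From mathcomp Require Import all_boot all_order all_algebra.
From mathcomp Require Import all_classical all_reals all_analysis.

Set Implicit Arguments.
Unset Strict Implicit.
Unset Printing Implicit Defensive.

Import Order.TTheory GRing.Theory Num.Theory.

Local Open Scope classical_set_scope.
Local Open Scope ring_scope.
Local Open Scope ereal_scope.

(* Throughout, observations are numbered from 1: a sequence [X] stands for
   X 1, X 2, ..., and no definition below depends on [X 0]. *)

Section Model.
Context (d d' : measure_display) (T : measurableType d) (S : measurableType d')
  (R : realType).
Implicit Types (P : probability T R) (X : nat -> {mfun T >-> S})
  (mu : {measure set S -> \bar R}) (f : S -> R).

Definition is_pdf mu f : Prop :=
  [/\ measurable_fun [set: S] f, (forall x, 0 <= f x)%R
    & \int[mu]_x (f x)%:E = 1].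

Definition has_density P mu (Y : {mfun T >-> S}) f : Prop :=
  forall A, measurable A -> distribution P Y A = \int[mu]_(x in A) (f x)%:E.

Definition independent_obs P X : Prop :=
  forall (J : seq nat) (A : nat -> set S),
    uniq J -> {in J, forall i, (1 <= i)%N} -> (forall i, measurable (A i)) ->
    P (\bigcap_(i in [set` J]) (X i @^-1` A i)) =
    \prod_(i <- J) P (X i @^-1` A i).

(* [P k] is the law of the experiment when the first post-change observation
   is the k-th one (k >= 1; [P 0] is unconstrained), [Pinf] its law when there
   is no change. *)
Record changepoint_model (P : nat -> probability T R) (Pinf : probability T R)
    X mu (f0 f1 : S -> R) : Prop := ChangepointModel {
  pdf_f0 : is_pdf mu f0 ;
  pdf_f1 : is_pdf mu f1 ;
  indep_Pinf : independent_obs Pinf X ;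
  density_Pinf : forall i, (1 <= i)%N -> has_density Pinf mu (X i) f0 ;
  indep_P : forall k, (1 <= k)%N -> independent_obs (P k) X ;
  density_P : forall k i, (1 <= k)%N -> (1 <= i)%N ->
    has_density (P k) mu (X i) (if (i < k)%N then f0 else f1) }.

Definition obs_filtration X (n : nat) : set (set T) :=
  <<s \bigcup_(i in [set i | 1 <= i <= n]%N)
        preimage_set_system [set: T] (X i) measurable >>.

(* Stopping times take values in the extended naturals, [None] being
   infinity. *)
Definition stopped_by (tau : option nat) (n : nat) : bool :=
  if tau is Some m then (m <= n)%N else false.

Definition is_stopping_time X (N : T -> option nat) : Prop :=
  forall n, obs_filtration X n [set w | stopped_by (N w) n].

Definition time_val (tau : option nat) : \bar R :=
  if tau is Some m then m%:R%:E else +oo.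

(* The quotient is that of the extended reals, so that the ratio is +oo where
   f0 = 0 < f1 (no absolute continuity is assumed), and 0 where f0 = f1 = 0. *)
Definition likelihood_ratio (f0 f1 : S -> R) (x : S) : \bar R :=
  (f1 x)%:E / (f0 x)%:E.

Definition SR_stat X f0 f1 (n : nat) (w : T) : \bar R :=
  \sum_(1 <= k < n.+1) \prod_(k <= i < n.+1) likelihood_ratio f0 f1 (X i w).

Definition SR_time X f0 f1 (A : R) (w : T) : option nat :=
  if pselect (exists n, (1 <= n)%N && (A%:E <= SR_stat X f0 f1 n w))
  is left ex then Some (ex_minn ex) else None.

Definition ARL2FA (Pinf : probability T R) (N : T -> option nat) : \bar R :=
  \int[Pinf]_w time_val (N w).

Definition Delta X (Pinf : probability T R) (B : R) : set (T -> option nat) :=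
  [set N | is_stopping_time X N /\ B%:E <= ARL2FA Pinf N].

Definition integral_delay (P : nat -> probability T R) (N : T -> option nat)
    : \bar R :=
  \sum_(1 <= k <oo) \int[P k]_w maxe (time_val (N w) - k%:R%:E) 0.

End Model.

(* Main.v *)
Require Import Defs.
From HB Require Import structures.
From mathcomp Require Import all_boot all_order all_algebra.
From mathcomp Require Import all_classical all_reals all_analysis.
From mathcomp Require Import measurable_realfun.

Set Implicit Arguments.
Unset Strict Implicit.
Unset Printing Implicit Defensive.

Import Order.TTheory GRing.Theory Num.Theory.
Import numFieldNormedType.Exports HBNNSimple.

Local Open Scope classical_set_scope.
Local Open Scope ring_scope.
Local Open Scope ereal_scope.

(** Write L for the likelihood ratio f1 / f0 and R_n = (1 + R_(n-1)) L(X_n),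
    with R_0 = 0, for the Shiryaev-Roberts statistic.

    The delay (N - k)^+ counts the n >= k with N > n, and the event N > n
    depends on the first n observations only. On those, the law P_k has the
    density L(X_k) ... L(X_n) with respect to P_oo, up to a part that is
    singular to P_oo because f0 may vanish where f1 does not. Summing over k,
    the integral delay of N is at least the sum over n of E_oo[R_n; N > n],
    called [SR_cost] below ([SR_cost_le_integral_delay]). For the
    Shiryaev-Roberts rule there is equality ([SR_cost_SR_time]), since a
    ratio L(X_i) = +oo stops that rule at once. It remains to minimize
    [SR_cost], an optimal stopping problem for the Markov chain R under P_oo,
    subject to E_oo N >= B.

    Let Q be the transition operator of this chain and let N_A be the rule
    with threshold A > 0. Suppose that a number lam >= 0 and a bounded
    function g >= 0 that vanishes on [A, +oo] satisfy lam + Q g(r) <= r +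
    g(r) for all r >= 0, with equality for r < A. Adding up these relations
    along the chain gives lam E_oo N <= SR_cost(N) + g(0) for every N
    ([price_le_SR_cost]) and SR_cost(N_A) + g(0) <= lam E_oo N_A
    ([SR_cost_le_price]). Since E_oo N_A = B <= E_oo N, the rule N_A is
    optimal.

    To find g, consider the problem in which a step from r earns lam and
    costs r, where one must stop from A on and may stop below A. Its value g
    is a limit of finite-horizon values ([gain]); it decreases in r and is
    Lipschitz in lam, the constant being the expected time that the chain
    spends below A, which is finite because E_oo N_A = B
    ([survival_time_le_ARL2FA]). The intermediate value theorem therefore
    provides a lam for which continuing at A itself has net value 0
    ([indifference_price]). By monotonicity in r, continuing is then
    worthwhile below A, so that the option to stop there is idle, and is not
    worthwhile above A; these are the required relations
    ([optimal_gain_bellman]).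

    If A <= 0, the rule stops at the first observation and has no delay. *)

(** * Integrals against densities, restrictions and joint laws *)

Section Integration.
Context d (T : measurableType d) (R : realType).

Lemma ge0_integral_mrestr (mu : {measure set T -> \bar R}) (E : set T)
    (mE : measurable E) (f : T -> \bar R) :
  measurable_fun [set: T] f -> (forall x, 0 <= f x) ->
  \int[mrestr mu mE]_x f x = \int[mu]_(x in E) f x.
Proof.
move=> mf f0.
rewrite [LHS](ge0_negligible_integral (N := ~` E))//=; last 2 first.
- exact: measurableC.
- by rewrite /mrestr setICl measure0.
rewrite setDE setTI setCK; apply: eq_measure_integral => A mA AE.
by rewrite /= /mrestr setIidl.
Qed.

(** By monotone convergence the identity reduces to simple functions, and then
    to indicators, where it is the hypothesis on [nu]. *)
Lemma ge0_integral_density (mu nu : {measure set T -> \bar R}) (f : T -> R)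
    (g : T -> \bar R) :
  measurable_fun [set: T] f -> (forall x, (0 <= f x)%R) ->
  (forall A, measurable A -> nu A = \int[mu]_(x in A) (f x)%:E) ->
  measurable_fun [set: T] g -> (forall x, 0 <= g x) ->
  \int[nu]_x g x = \int[mu]_x (g x * (f x)%:E).
Proof.
move=> mf f0 nuE mg g0; pose h := nnsfun_approx measurableT mg.
have mfE : measurable_fun [set: T] (EFin \o f) by exact/measurable_EFinP.
have cvgh x : EFin \o h ^~ x @ \oo --> g x.
  by apply: cvg_nnsfun_approx => // y _; exact: g0.
have ndh x : {homo (fun n => (h n x)%:E) : m n / (m <= n)%N >-> m <= n}.
  by move=> m n mn; rewrite lee_fin; exact/lefP/nd_nnsfun_approx.
transitivity (limn (fun n => \int[nu]_x (h n x)%:E)).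
  rewrite -monotone_convergence//.
  - by apply: eq_integral => x _; apply/esym/cvg_lim => //; exact: cvgh.
  - by move=> n; exact/measurable_EFinP/measurable_funP.
  - by move=> n x _; rewrite lee_fin.
transitivity (limn (fun n => \int[mu]_x ((h n x)%:E * (f x)%:E))); last first.
  rewrite -monotone_convergence//.
  - apply: eq_integral => x _; apply: cvg_lim => //.
    by apply: cvgeZr => //; exact: cvgh.
  - move=> n; apply: emeasurable_funM => //.
    exact/measurable_EFinP/measurable_funP.
  - by move=> n x _; rewrite mule_ge0// lee_fin.
  - by move=> x _ m n mn; rewrite lee_wpmul2r ?lee_fin ?f0//; exact: ndh.
congr (limn _); apply/funext => n.
have mh r :
    measurable_fun [set: T] (fun x => (r * \1_(h n @^-1` [set r]) x)%:E).
  by apply/measurable_EFinP; exact: measurable_funM.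
transitivity (\int[nu]_x
    (\sum_(y \in range (h n)) (y * \1_(h n @^-1` [set y]) x)%:E)).
  by apply: eq_integral => t _; rewrite /= fimfunE -fsumEFin.
rewrite ge0_integral_fsum//; last by move=> m y Ey; exact: nnfun_muleindic_ge0.
transitivity (\int[mu]_x (\sum_(y \in range (h n))
    (y * \1_(h n @^-1` [set y]) x)%:E * (f x)%:E)); last first.
  apply: eq_integral => x _.
  rewrite -ge0_mule_fsuml => [|y]; last exact: nnfun_muleindic_ge0.
  by rewrite fsumEFin // -(fimfunE _ x).
rewrite ge0_integral_fsum//; last 2 first.
- by move=> y; exact: emeasurable_funM.
- move=> m y Ey; rewrite mule_ge0 ?lee_fin ?f0//.
  by rewrite -lee_fin nnfun_muleindic_ge0.
apply: eq_fsbigr => r rhn.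
under [LHS]eq_integral do rewrite EFinM.
rewrite integralZl_indic_nnsfun//.
under [RHS]eq_integral do rewrite EFinM -muleA.
rewrite ge0_integralZl//.
- under [in RHS]eq_integral do rewrite muleC.
  rewrite [X in _ = _ * X](eq_integral ((EFin \o f) \_ (h n @^-1` [set r]))).
    by rewrite -integral_mkcond -nuE// integral_indic// setIT.
  by move=> x xE; rewrite epatch_indic.
- by apply: emeasurable_funM => //; exact/measurable_EFinP.
- by move=> t _; rewrite mule_ge0 ?lee_fin.
- by move: rhn; rewrite inE => -[t _ <-]; rewrite lee_fin.
Qed.

End Integration.

(** Gives access to the uniqueness theorems for measures when one of the two
    set functions to compare is an integral. *)
Lemma integral_measure_exists d (T : measurableType d) (R : realType)
    (mu : {measure set T -> \bar R}) (f : T -> \bar R) :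
  measurable_fun [set: T] f -> (forall x, 0 <= f x) ->
  exists nu : {measure set T -> \bar R},
    forall A, nu A = \int[mu]_(x in A) f x.
Proof.
move=> mf f0; pose nu A := \int[mu]_(x in A) f x.
have nu0 : nu set0 = 0 by exact: integral_set0.
have nu_ge0 A : 0 <= nu A by exact: integral_ge0.
have nuU : semi_sigma_additive nu.
  move=> F mF tF mUF; rewrite /nu ge0_integral_bigcup//; last first.
    exact: measurable_funTS.
  by apply: is_cvg_nneseries => n _ _; exact: integral_ge0.
pose m : {measure set T -> \bar R} := HB.pack nu
  (isMeasure.Build _ _ _ nu nu0 nu_ge0 nuU).
by exists m.
Qed.

Section JointLaw.
Context d d1 d2 (T : measurableType d) (T1 : measurableType d1)
  (T2 : measurableType d2) (R : realType).
Variables (P : probability T R) (E : set T) (mE : measurable E).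
Variables (Y : {mfun T >-> T1}) (Z : {mfun T >-> T2}).

(** A finite measure, of mass [P E], so that it can enter a product measure. *)
Definition restricted_law (A : set T1) := P (E `&` Y @^-1` A).

Let mY A : measurable A -> measurable (Y @^-1` A).
Proof.
by move=> mA; rewrite -[X in measurable X]setTI; exact: measurable_funP.
Qed.

Let restricted_law_0 : restricted_law set0 = 0.
Proof. by rewrite /restricted_law preimage_set0 setI0 measure0. Qed.

Let restricted_law_ge0 A : 0 <= restricted_law A.
Proof. exact: measure_ge0. Qed.

Let restricted_law_sigma_additive : semi_sigma_additive restricted_law.
Proof.
move=> F mF tF mUF; rewrite /restricted_law preimage_bigcup setI_bigcupr.
apply: measure_semi_sigma_additive.
- by move=> n; apply: measurableI => //; exact: mY.
- apply: trivIset_setIl; apply/trivIsetP => i j _ _ ij.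
  by rewrite -preimage_setI ((trivIsetP.1 tF) i j)// preimage_set0.
- by apply: bigcupT_measurable => n; apply: measurableI => //; exact: mY.
Qed.

HB.instance Definition _ := isMeasure.Build _ _ _ restricted_law
  restricted_law_0 restricted_law_ge0 restricted_law_sigma_additive.

Let restricted_law_fin : fin_num_fun restricted_law.
Proof.
move=> A mA; apply: fin_num_measure.
by apply: measurableI => //; exact: mY.
Qed.

HB.instance Definition _ := Measure_isFinite.Build _ _ _ restricted_law
  restricted_law_fin.

(** The law of [(Y, Z)] on [E] agrees on rectangles with the product of the two
    marginal laws, hence is that product, and Tonelli's theorem applies. *)
Lemma ge0_integral_indep (f : T1 * T2 -> \bar R) :
  (forall A B, measurable A -> measurable B ->
    P (E `&` Y @^-1` A `&` Z @^-1` B) = P (E `&` Y @^-1` A) * P (Z @^-1` B)) ->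
  measurable_fun [set: T1 * T2] f -> (forall x, 0 <= f x) ->
  \int[P]_(w in E) f (Y w, Z w) =
  \int[P]_(w in E) \int[distribution P Z]_z f (Y w, z).
Proof.
move=> ind mf f0.
pose YZ w := (Y w, Z w).
have mYZ : measurable_fun [set: T] YZ by exact: measurable_fun_pair.
transitivity (\int[mrestr P mE]_w f (YZ w)).
  by rewrite ge0_integral_mrestr//; exact: measurableT_comp.
transitivity (\int[pushforward (mrestr P mE) YZ]_z f z).
  by rewrite ge0_integral_pushforward.
rewrite (eq_measure_integral (restricted_law \x distribution P Z)); last first.
  move=> A mA _; apply/esym; apply: product_measure_unique => // B C mB mC.
  rewrite /= /pushforward /mrestr /restricted_law -ind//; congr (P _).
  by apply/seteqP; split => w /=; rewrite /YZ /=; tauto.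
rewrite fubini_tonelli1// /fubini_F.
have mF : measurable_fun [set: T1] (fun y => \int[distribution P Z]_z f (y, z)).
  exact: measurable_fun_fubini_tonelli_F.
have F0 y : 0 <= \int[distribution P Z]_z f (y, z) by exact: integral_ge0.
transitivity (\int[pushforward (mrestr P mE) Y]_y
    \int[distribution P Z]_z f (y, z)).
  apply: eq_measure_integral => A mA _.
  by rewrite /= /pushforward /mrestr setIC.
rewrite ge0_integral_pushforward// preimage_setT ge0_integral_mrestr//.
  exact: measurableT_comp.
by move=> x; exact: F0.
Qed.

End JointLaw.

(** * The filtration of the observations *)

Section Filtration.
Context d d' (T : measurableType d) (S : measurableType d') (R : realType).
Variable X : nat -> {mfun T >-> S}.
Implicit Types (P : probability T R) (n : nat).

Let gen n := \bigcup_(i in [set i | 1 <= i <= n]%N)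
  preimage_set_system [set: T] (X i) measurable.

(** The sample space under the sigma-algebra of the first [n] observations:
    being determined by the past becomes measurability of a plain function. *)
Definition obsType n := g_sigma_algebraType (gen n).

Lemma obs_measurableE n (E : set T) :
  measurable (E : set (obsType n)) = obs_filtration X n E.
Proof. by []. Qed.

Lemma preimage_obs_filtration n i (A : set S) :
  (1 <= i <= n)%N -> measurable A -> obs_filtration X n (X i @^-1` A).
Proof.
move=> ilen mA; apply: sub_sigma_algebra; exists i => //.
by exists A => //; rewrite setTI.
Qed.

Lemma obs_filtration_measurable n E : obs_filtration X n E -> measurable E.
Proof.
apply: smallest_sub; first exact: sigma_algebra_measurable.
move=> _ [i _ [A mA <-]]; exact: measurable_funP.
Qed.

Lemma le_obs_filtration m n E :
  (m <= n)%N -> obs_filtration X m E -> obs_filtration X n E.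
Proof.
move=> mn; apply: sub_smallest2r; first exact: smallest_sigma_algebra.
by move=> B [i /andP[i1 im] XiB]; exists i => //=; rewrite i1 (leq_trans im).
Qed.

Lemma measurable_obs n i : (1 <= i <= n)%N ->
  measurable_fun [set: obsType n] (X i : obsType n -> S).
Proof.
by move=> ilen _ A mA; rewrite setTI; exact: preimage_obs_filtration.
Qed.

Lemma obs_measurable_fun n d1 (T1 : measurableType d1) (Y : T -> T1) :
  measurable_fun [set: obsType n] (Y : obsType n -> T1) ->
  measurable_fun [set: T] Y.
Proof.
by move=> mY _ A mA; apply: (@obs_filtration_measurable n); exact: mY.
Qed.

Lemma le_obs_measurable_fun m n d1 (T1 : measurableType d1) (Y : T -> T1) :
  (m <= n)%N -> measurable_fun [set: obsType m] (Y : obsType m -> T1) ->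
  measurable_fun [set: obsType n] (Y : obsType n -> T1).
Proof.
by move=> mn mY _ A mA; apply: (le_obs_filtration mn); exact: mY.
Qed.

Definition cylinder n (A : nat -> set S) : set T :=
  \bigcap_(i in [set i | 1 <= i <= n]%N) (X i @^-1` A i).

Lemma cylinderS n A : cylinder n.+1 A = cylinder n A `&` X n.+1 @^-1` A n.+1.
Proof.
apply/seteqP; split=> w.
  move=> c; split; last by apply: c => /=; rewrite ltnSn.
  by move=> i /andP[i1 ilen]; apply: c; rewrite /= i1 leqW.
move=> [c XSn] i /= /andP[i1]; rewrite leq_eqVlt => /predU1P[->//|].
by rewrite ltnS => ilen; apply: c; rewrite /= i1.
Qed.

Let cylinders n :=
  [set cylinder n A | A in [set A | forall i, measurable (A i)]].

Let obs_filtration_cylinders n : obs_filtration X n = <<s cylinders n >>.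
Proof.
apply/seteqP; split; apply: smallest_sub;
  try exact: smallest_sigma_algebra.
  move=> _ [i /= ilen [A mA <-]]; apply: sub_sigma_algebra.
  exists (fun j => if j == i then A else setT) => /=.
    by move=> j; case: ifP.
  rewrite setTI; apply/seteqP; split=> w.
    by move=> /(_ i ilen) /=; rewrite eqxx.
  by move=> Aw j _ /=; case: eqP => [->|].
move=> _ [A mA <-]; rewrite -[X in X _]/(@measurable _ (obsType n)).
apply: bigcap_measurableType => i ilen.
exact: preimage_obs_filtration.
Qed.

Let cylindersI n : setI_closed (cylinders n).
Proof.
move=> _ _ [A mA <-] [B mB <-]; exists (fun i => A i `&` B i).
  by move=> i; exact: measurableI.
apply/seteqP; split=> w.
  by move=> c; split=> i /c[].
by move=> [cA cB] i ilen; split; [exact: cA|exact: cB].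
Qed.

(** Cylinders form a pi-system that generates the sigma-algebra. *)
Lemma eq_measure_obs_filtration n (m1 m2 : {measure set T -> \bar R}) :
  m1 setT < +oo ->
  (forall A, (forall i, measurable (A i)) ->
    m1 (cylinder n A) = m2 (cylinder n A)) ->
  forall E, obs_filtration X n E -> m1 E = m2 E.
Proof.
move=> fin1 m12; rewrite obs_filtration_cylinders.
have cT : cylinders n setT.
  by exists (fun=> setT) => //; apply/seteqP; split=> // w _ i.
apply: (g_sigma_algebra_measure_unique (cylinders n) _ (fun=> setT)) => //.
- move=> _ [A mA <-]; apply: (@obs_filtration_measurable n).
  by rewrite obs_filtration_cylinders; apply: sub_sigma_algebra; exists A.
- by rewrite bigcup_const//; exists 0%N.
- by move=> _ [A mA <-]; exact: m12.
Qed.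

Lemma cylinder_obs_filtration n A :
  (forall i, measurable (A i)) -> obs_filtration X n (cylinder n A).
Proof.
move=> mA; rewrite obs_filtration_cylinders.
by apply: sub_sigma_algebra; exists A.
Qed.

Lemma measurable_cylinder n A :
  (forall i, measurable (A i)) -> measurable (cylinder n A).
Proof.
move=> mA; apply: (@obs_filtration_measurable n).
exact: cylinder_obs_filtration.
Qed.

Section Independent.
Variable P : probability T R.
Hypothesis indP : independent_obs P X.

Lemma prob_cylinder n A : (forall i, measurable (A i)) ->
  P (cylinder n A) = \prod_(1 <= i < n.+1) P (X i @^-1` A i).
Proof.
move=> mA; rewrite -indP//.
- congr (P _); rewrite /cylinder; congr bigcap.
  by apply/seteqP; split=> i /=; rewrite mem_index_iota ltnS.
- exact: iota_uniq.
- by move=> i; rewrite mem_index_iota => /andP[].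
Qed.

(** Both sides are finite measures of [E] which agree on cylinders. *)
Lemma prob_next_obs n E (B : set S) : obs_filtration X n E -> measurable B ->
  P (E `&` X n.+1 @^-1` B) = P E * P (X n.+1 @^-1` B).
Proof.
move=> FE mB.
have mXB : measurable (X n.+1 @^-1` B).
  by rewrite -[X in measurable X]setTI; exact: measurable_funP.
pose p : {nonneg R} := NngNum (fine_ge0 (measure_ge0 P (X n.+1 @^-1` B))).
have pE : P (X n.+1 @^-1` B) = p%:num%:E by rewrite fineK// fin_num_measure.
rewrite pE muleC.
apply: (@eq_measure_obs_filtration n (mrestr P mXB) (mscale p P)) => //.
  by rewrite /mrestr /= (le_lt_trans (probability_le1 _ _))// ?ltry// setTI.
move=> A mA; rewrite /= /mrestr /mscale -pE.
(* The cylinder of length [n.+1] that constrains the last observation by [B]. *)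
pose A' i := if i == n.+1 then B else A i.
have mA' i : measurable (A' i) by rewrite /A'; case: ifP.
rewrite [X in P X](_ : _ = cylinder n.+1 A'); last first.
  rewrite cylinderS {2}/A' eqxx; congr (_ `&` _).
  apply: eq_bigcapr => i /andP[_ ilen]; rewrite /A' ifF//.
  by apply/negbTE; rewrite neq_ltn ltnS ilen.
rewrite (prob_cylinder n.+1 mA') big_nat_recr//= muleC {1}/A' eqxx.
rewrite (prob_cylinder n mA); congr (_ * _).
apply: eq_big_nat => i /andP[_ ilen]; rewrite /A' ifF//.
by apply/negbTE; rewrite neq_ltn ilen.
Qed.

Lemma ge0_integral_next_obs n E d1 (T1 : measurableType d1) (Y : T -> T1)
    (f : T1 * S -> \bar R) :
  obs_filtration X n E ->
  measurable_fun [set: obsType n] (Y : obsType n -> T1) ->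
  measurable_fun [set: T1 * S] f -> (forall x, 0 <= f x) ->
  \int[P]_(w in E) f (Y w, X n.+1 w) =
  \int[P]_(w in E) \int[distribution P (X n.+1)]_x f (Y w, x).
Proof.
move=> FE mY mf f0; have mYT := obs_measurable_fun mY.
pose Ym : {mfun T >-> T1} := HB.pack Y (isMeasurableFun.Build _ _ _ _ _ mYT).
apply: (@ge0_integral_indep _ _ _ _ _ _ _ P E _ Ym (X n.+1)) => //.
  exact: (obs_filtration_measurable FE).
move=> A B mA mB; apply: prob_next_obs => //.
apply: (@measurableI _ (obsType n)) => //.
by rewrite -[X in measurable X]setTI; exact: mY.
Qed.

End Independent.

End Filtration.

(** * Likelihood ratios and the change of measure *)

Section ChangeOfMeasure.
Context d d' (T : measurableType d) (S : measurableType d') (R : realType).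
Variables (mu : {measure set S -> \bar R}) (f0 f1 : S -> R).
Variables (X : nat -> {mfun T >-> S}).
Variables (P : nat -> probability T R) (Pinf : probability T R).
Hypothesis hmodel : changepoint_model P Pinf X mu f0 f1.

Local Notation L := (likelihood_ratio f0 f1).

Let mf0 : measurable_fun [set: S] f0. Proof. by case: (pdf_f0 hmodel). Qed.
Let mf1 : measurable_fun [set: S] f1. Proof. by case: (pdf_f1 hmodel). Qed.
Let f0_ge0 x : (0 <= f0 x)%R. Proof. by case: (pdf_f0 hmodel). Qed.
Let f1_ge0 x : (0 <= f1 x)%R. Proof. by case: (pdf_f1 hmodel). Qed.

Lemma likelihood_ratio_ge0 x : 0 <= L x.
Proof. by rewrite mule_ge0 ?inve_ge0 ?lee_fin. Qed.

Lemma likelihood_ratioE x :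
  L x = if f0 x == 0%R then (if f1 x == 0%R then 0 else +oo)
        else (f1 x / f0 x)%:E.
Proof.
rewrite /likelihood_ratio inver; case: ifPn => // _.
case: eqVneq => [->|f1x]; first by rewrite mul0e.
by rewrite gt0_muley// lte_fin lt_neqAle eq_sym f1x f1_ge0.
Qed.

Let measurable_eq0 (f : S -> R) : measurable_fun [set: S] f ->
  measurable_fun [set: S] (fun x => f x == 0%R).
Proof. by move=> mf; exact: measurable_fun_eqr. Qed.

Lemma measurable_likelihood_ratio : measurable_fun [set: S] L.
Proof.
rewrite (funext likelihood_ratioE); apply: measurable_fun_ifT.
- exact: measurable_eq0.
- by apply: measurable_fun_ifT => //; exact: measurable_eq0.
- rewrite (_ : (fun _ => _) = (fun x => (f1 x * (f0 x)^-1)%:E))//.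
  apply/measurable_EFinP; apply: measurable_funM => //.
  rewrite (_ : (fun _ => _) = (fun x => f0 x `^ (-1))%R); last first.
    by apply/funext => x; rewrite powR_inv1.
  exact: (measurableT_comp (measurable_powR (-1)%R) mf0).
Qed.


Let measurable_neq0 (f : S -> R) : measurable_fun [set: S] f ->
  measurable [set x | f x != 0%R].
Proof.
move=> mf; rewrite (_ : [set x | _] = f @^-1` [set~ 0%R]).
  by rewrite -[X in measurable X]setTI; apply: mf => //; exact: measurableC.
by apply/seteqP; split=> x /=; move/eqP.
Qed.

Let U := [set x | f0 x != 0%R].

Let mU : measurable U. Proof. exact: measurable_neq0. Qed.

Let mem_set_neq0 x : (x \in U) = (f0 x != 0%R).
Proof. by apply/idP/idP; rewrite inE. Qed.

(** Since [f0] may vanish where [f1] does not, the ratio recovers only the part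
    of the post-change law that is absolutely continuous. *)
Lemma integral_likelihood_ratio k i j A :
  (1 <= i)%N -> (1 <= k <= j)%N -> measurable A ->
  \int[distribution Pinf (X i)]_(x in A) L x = P k (X j @^-1` (A `&` U)).
Proof.
move=> i1 /andP[k1 kj] mA.
rewrite integral_mkcond (ge0_integral_density (mu := mu) (f := f0))//.
- have := density_P hmodel k1 (leq_trans k1 kj) (measurableI _ _ mA mU).
  rewrite /distribution /pushforward => ->.
  rewrite ltnNge kj /= [in RHS]integral_mkcond; apply: eq_integral => x _.
  rewrite !patchE in_setI; case: (x \in A) => /=; last by rewrite mul0e.
  rewrite mem_set_neq0 likelihood_ratioE; case: ifPn => [/eqP ->|f0x] /=.
    by rewrite mule0.
  by rewrite -EFinM -mulrA mulVf// mulr1.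
- exact: (density_Pinf hmodel).
- apply/(measurable_restrictT _ _).1 => //.
  exact/measurable_funTS/measurable_likelihood_ratio.
- by move=> x; rewrite patchE; case: ifP => // _; exact: likelihood_ratio_ge0.
Qed.

Definition likelihood_product k n (w : T) : \bar R :=
  \prod_(k <= i < n.+1) L (X i w).

Lemma likelihood_product_ge0 k n w : 0 <= likelihood_product k n w.
Proof. by apply: prode_ge0 => i _; exact: likelihood_ratio_ge0. Qed.

Lemma likelihood_product_recr k n w : (k <= n.+1)%N ->
  likelihood_product k n.+1 w = likelihood_product k n w * L (X n.+1 w).
Proof. by move=> kn; rewrite /likelihood_product big_nat_recr. Qed.

Lemma likelihood_product_geq k n w : (n < k)%N -> likelihood_product k n w = 1.
Proof. by move=> nk; rewrite /likelihood_product big_geq. Qed.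

Lemma measurable_obs_likelihood_ratio n i : (1 <= i <= n)%N ->
  measurable_fun [set: obsType X n] (fun w : obsType X n => L (X i w)).
Proof.
move=> ilen; apply: measurableT_comp; first exact: measurable_likelihood_ratio.
exact: measurable_obs.
Qed.

Lemma measurable_likelihood_product k n : (1 <= k)%N ->
  measurable_fun [set: obsType X n]
    (likelihood_product k n : obsType X n -> \bar R).
Proof.
move=> k1; elim: n => [|n IHn].
  by rewrite (_ : likelihood_product k 0 = cst 1)//; apply/funext => w;
    rewrite likelihood_product_geq.
have [kn|nk] := leqP k n.+1; last first.
  by rewrite (_ : likelihood_product k n.+1 = cst 1)//; apply/funext => w;
    rewrite likelihood_product_geq.
rewrite (funext (fun w => likelihood_product_recr w kn)).
apply: emeasurable_funM; first exact: (le_obs_measurable_fun (leqnSn n)).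
by apply: measurable_obs_likelihood_ratio; rewrite ltnSn.
Qed.

Let regular k i : set S := if (k <= i)%N then U else setT.

Let mregular k i : measurable (regular k i).
Proof. by rewrite /regular; case: ifP. Qed.

Let prob_before k i A : (1 <= i < k)%N -> measurable A ->
  P k (X i @^-1` A) = Pinf (X i @^-1` A).
Proof.
move=> /andP[i1 ik] mA; have k1 : (1 <= k)%N := leq_trans i1 (ltnW ik).
have := density_P hmodel k1 i1 mA; have := density_Pinf hmodel i1 mA.
by rewrite /distribution /pushforward ik => -> ->.
Qed.

(** The last observation is independent of the earlier ones and can be
    integrated out, so that both sides are the same product over [i]; before
    time [k] the two laws coincide and the likelihood product is empty. *)
Let integral_likelihood_product_cylinder k n A :
  (1 <= k)%N -> (forall i, measurable (A i)) ->
  \int[Pinf]_(w in cylinder X n A) likelihood_product k n w =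
  P k (cylinder X n (fun i => A i `&` regular k i)).
Proof.
move=> k1 mA.
have mAr i : measurable (A i `&` regular k i) by exact: measurableI.
rewrite (prob_cylinder (indep_P hmodel k1))//.
have early m : (m < k)%N ->
    \int[Pinf]_(w in cylinder X m A) likelihood_product k m w =
    \prod_(1 <= i < m.+1) P k (X i @^-1` (A i `&` regular k i)).
  move=> mk; under eq_integral do rewrite likelihood_product_geq//.
  rewrite integral_cst ?mul1e; last first.
    exact: measurable_cylinder.
  rewrite [LHS](prob_cylinder (indep_Pinf hmodel) m mA).
  apply: eq_big_nat => i /andP[i1 im]; have ik := leq_trans im mk.
  by rewrite /regular leqNgt ik /= setIT prob_before// i1.
elim: n => [|n IHn]; first exact: early.
have [nk|kn] := ltnP n.+1 k; first exact: early.
have mLA : measurable_fun [set: S] (L \_ (A n.+1)).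
  apply/(measurable_restrictT _ _).1 => //.
  exact/measurable_funTS/measurable_likelihood_ratio.
have LA_ge0 x : 0 <= (L \_ (A n.+1)) x.
  by rewrite patchE; case: ifP => // _; exact: likelihood_ratio_ge0.
transitivity (\int[Pinf]_(w in cylinder X n A)
    (likelihood_product k n w * (L \_ (A n.+1)) (X n.+1 w))).
  rewrite cylinderS integral_mkcondr; apply: eq_integral => w _.
  rewrite !patchE likelihood_product_recr//.
  rewrite (_ : (w \in _) = (X n.+1 w \in A n.+1)); last first.
    by apply/idP/idP; rewrite !inE.
  by case: ifP => // _; rewrite mule0.
have FA : obs_filtration X n (cylinder X n A) by exact: cylinder_obs_filtration.
(* The truncation at 0 makes the integrand nonnegative on the whole product. *)
pose F (yx : \bar R * S) := maxe 0 yx.1 * (L \_ (A n.+1)) yx.2.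
have FE w x : likelihood_product k n w * (L \_ (A n.+1)) x =
    F (likelihood_product k n w, x).
  by rewrite /F/= max_r//; exact: likelihood_product_ge0.
under eq_integral do rewrite FE.
rewrite (ge0_integral_next_obs (indep_Pinf hmodel) FA)//; last 3 first.
- exact: measurable_likelihood_product.
- apply: emeasurable_funM.
    by apply: measurable_maxe => //; exact: measurable_fst.
  by apply: measurableT_comp => //; exact: measurable_snd.
- by move=> yx; rewrite mule_ge0// le_max lexx.
under eq_integral do under eq_integral do rewrite -FE.
under eq_integral => w _.
  rewrite ge0_integralZl//; last exact: likelihood_product_ge0.
  rewrite -integral_mkcond (integral_likelihood_ratio (k := k) (j := n.+1))//.
    over.
  by rewrite k1.
rewrite ge0_integralZr//; last 3 first.
- exact: (obs_filtration_measurable FA).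
- apply: measurable_funTS; apply: obs_measurable_fun.
  exact: measurable_likelihood_product.
- by move=> w _; exact: likelihood_product_ge0.
rewrite IHn [RHS]big_nat_recr//=.
by congr (_ * P k (X n.+1 @^-1` (_ `&` _))); rewrite /regular kn.
Qed.



Let integral_likelihood_product k n E : (1 <= k)%N -> obs_filtration X n E ->
  \int[Pinf]_(w in E) likelihood_product k n w =
  P k (E `&` cylinder X n (regular k)).
Proof.
move=> k1 FE.
have [nu nuE] : exists nu : {measure set T -> \bar R},
    forall A, nu A = \int[Pinf]_(w in A) likelihood_product k n w.
  apply: integral_measure_exists; last exact: likelihood_product_ge0.
  by apply: obs_measurable_fun; exact: measurable_likelihood_product.
have mreg : measurable (cylinder X n (regular k)) by exact: measurable_cylinder.
rewrite -nuE; apply/esym.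
apply: (@eq_measure_obs_filtration _ _ _ _ _ X n (mrestr (P k) mreg)) => //.
  rewrite /= /mrestr setTI (le_lt_trans (probability_le1 _ _))// ltry.
  by [].
move=> A mA; rewrite nuE integral_likelihood_product_cylinder//=.
rewrite /mrestr; congr (P k _); apply/seteqP; split => w /=.
  by move=> [cA cr] i ilen; split; [exact: cA|exact: cr].
by move=> c; split=> i /c[].
Qed.

(** Only an inequality, because the singular part of [P k] is lost. *)
Lemma integral_likelihood_product_le k n E :
  (1 <= k)%N -> obs_filtration X n E ->
  \int[Pinf]_(w in E) likelihood_product k n w <= P k E.
Proof.
move=> k1 FE; rewrite integral_likelihood_product// le_measure ?inE//.
- apply: measurableI; last exact: measurable_cylinder.
  exact: (obs_filtration_measurable FE).
- exact: (obs_filtration_measurable FE).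
Qed.

(** Under [P k] an observation made after the change almost surely has [f0] or
    [f1] nonzero there, so that a finite ratio excludes [f0 = 0]: on [E] there
    is no singular part to lose. *)
Lemma integral_likelihood_product_eq k n E :
  (1 <= k)%N -> obs_filtration X n E ->
  (forall w i, E w -> (k <= i <= n)%N -> L (X i w) < +oo) ->
  \int[Pinf]_(w in E) likelihood_product k n w = P k E.
Proof.
move=> k1 FE Lfin; apply/eqP; rewrite eq_le integral_likelihood_product_le//=.
rewrite integral_likelihood_product//.
pose V i := if (k <= i)%N then U `|` [set x | f1 x != 0%R] else setT.
have mV i : measurable (V i).
  rewrite /V; case: ifP => // _; apply: measurableU => //.
  exact: measurable_neq0.
have PV : P k (cylinder X n V) = 1.
  rewrite (prob_cylinder (indep_P hmodel k1) n mV) big_nat big1// => i.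
  rewrite /V; case: ifPn => [ki|_] /andP[i1 _]; last first.
    by rewrite preimage_setT probability_setT.
  have mU1 : measurable (U `|` [set x | f1 x != 0%R]).
    by apply: measurableU => //; exact: measurable_neq0.
  have := density_P hmodel k1 i1 mU1.
  rewrite /distribution /pushforward => ->; rewrite ltnNge ki /=.
  case: (pdf_f1 hmodel) => _ _ <-; rewrite integral_mkcond.
  apply: eq_integral => x _; rewrite patchE; case: ifPn => // xU.
  apply/esym/eqP; rewrite eqe; apply/negPn/negP => f1x.
  by move/negP: xU; apply; rewrite inE; right.
have mC : measurable (cylinder X n V) by exact: measurable_cylinder.
have mE := obs_filtration_measurable FE.
have mG : measurable (E `&` cylinder X n (regular k)).
  by apply: measurableI => //; exact: measurable_cylinder.
apply: (@le_trans _ _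
  (P k ((E `&` cylinder X n (regular k)) `|` ~` cylinder X n V))).
  apply: le_measure; rewrite ?inE//.
    by apply: measurableU => //; exact: measurableC.
  move=> w Ew; have [cV|] := pselect (cylinder X n V w); last by right.
  left; split=> // i ilen; rewrite /regular /=.
  case: ifPn => // ki; have /andP[_ len] := ilen.
  have := cV i ilen; rewrite /V /= ki => -[//|/= f1x].
  have := Lfin w i Ew; rewrite ki len => /(_ isT).
  rewrite likelihood_ratioE (negbTE f1x).
  by case: ifPn => // _; rewrite ltxx.
apply: (le_trans (measureU2 _ _ _)) => //; first exact: measurableC.
rewrite [X in _ + X](_ : _ = 0) ?adde0//.
by have := probability_setC (P k) mC; rewrite PV subee.
Qed.

End ChangeOfMeasure.

(** * The optimal stopping problem for the Shiryaev-Roberts recursion *)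

(** Extended constantly to the left of [a], such a function is Lipschitz on the
    whole line, hence continuous. *)
Lemma nondecreasing_lipschitz_IVT (R : realType) (f : R -> R) (a b v k : R) :
  (a <= b)%R -> (0 <= k)%R ->
  (forall x y, a <= x -> x <= y -> f x <= f y <= f x + (y - x) * k)%R ->
  (f a <= v <= f b)%R -> exists2 c, (a <= c <= b)%R & f c = v.
Proof.
move=> ab k0 fk favfb; pose g x := f (Num.max a x).
have glip x y : (x <= y -> `|g x - g y| <= k * `|x - y|)%R.
  move=> xy; have maxxy : (Num.max a x <= Num.max a y)%R by rewrite le_max2.
  have amax : (a <= Num.max a x)%R by rewrite le_max lexx.
  have /andP[gle gge] := fk _ _ amax maxxy.
  rewrite distrC ger0_norm ?subr_ge0// lerBlDl distrC ger0_norm ?subr_ge0//.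
  rewrite (le_trans gge)// lerD2l mulrC ler_wpM2l//.
  rewrite /Num.max; case: (ltrP a x) => ax; case: (ltrP a y) => ay.
  - by [].
  - by have := lt_le_trans ax (le_trans xy ay); rewrite ltxx.
  - by rewrite lerD2l lerN2.
  - by rewrite subrr subr_ge0.
have gcont : continuous g.
  move=> x; apply/cvgrPdist_le => e e0.
  (* The modulus is [e / (k + 1)] rather than [e / k] since [k] may be 0. *)
  have k1 : (0 < k + 1)%R by rewrite ltr_wpDl.
  have : \forall y \near x, (`|x - y| <= e / (k + 1))%R.
    have /cvgrPdist_le := @cvg_id _ (nbhs x).
    by apply; rewrite divr_gt0.
  apply: filterS => y xy.
  have : (`|g x - g y| <= k * `|x - y|)%R.
    have [|/ltW yx] := leP x y; first exact: glip.
    by rewrite distrC (distrC x) glip.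
  move=> /le_trans; apply; apply: (@le_trans _ _ (k * (e / (k + 1)))%R).
    by rewrite ler_wpM2l.
  rewrite mulrCA; apply: ler_piMr; first exact: ltW.
  by rewrite ler_pdivrMr// mul1r lerDl.
have [|c /itvP cab gcv] := @IVT R g a b v ab (continuous_subspaceT gcont).
  rewrite /g maxxx max_r//; move/andP: favfb => [fav vfb].
  by rewrite ge_min fav le_max vfb orbT.
exists c; first by rewrite !cab.
by rewrite -gcv /g max_r// cab.
Qed.

Section OptimalStopping.
Context d (S : measurableType d) (R : realType).
Variables (law : probability S R) (L : S -> \bar R).
Hypothesis mL : measurable_fun [set: S] L.
Hypothesis L_ge0 : forall x, 0 <= L x.
Implicit Types (g h : \bar R -> \bar R) (r : \bar R).

(** The Markov operator of the chain that moves from [r] to [(1 + r) * L x],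
    with [x] drawn from [law]. *)
Definition transition g r : \bar R := \int[law]_x g ((1 + r) * L x).

Let next_ge0 r x : 0 <= r -> 0 <= (1 + r) * L x.
Proof. by move=> r0; rewrite mule_ge0// adde_ge0. Qed.

Let next_mono r r' x : 0 <= r -> r <= r' -> (1 + r) * L x <= (1 + r') * L x.
Proof. by move=> r0 rr'; rewrite lee_wpmul2r// leeD2l. Qed.

Lemma transition_ge0 g r : (forall r, 0 <= g r) -> 0 <= transition g r.
Proof. by move=> g0; exact: integral_ge0. Qed.

Lemma measurable_next : measurable_fun [set: \bar R * S]
  (fun rx : \bar R * S => (1 + rx.1) * L rx.2).
Proof.
apply: emeasurable_funM.
  by apply: emeasurable_funD => //; exact: measurable_fst.
by apply: measurableT_comp => //; exact: measurable_snd.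
Qed.

Let measurable_next_r r : measurable_fun [set: S] (fun x => (1 + r) * L x).
Proof. exact: emeasurable_funM. Qed.

Lemma measurable_transition g : measurable_fun [set: \bar R] g ->
  (forall r, 0 <= g r) -> measurable_fun [set: \bar R] (transition g).
Proof.
move=> mg g0; pose f (rx : \bar R * S) := g ((1 + rx.1) * L rx.2).
apply: (measurable_fun_fubini_tonelli_F f) => //.
  by apply: measurableT_comp => //; exact: measurable_next.
by move=> rx; exact: g0.
Qed.

Section Transition.
Variables g h : \bar R -> \bar R.
Hypotheses (mg : measurable_fun [set: \bar R] g) (g0 : forall r, 0 <= g r).
Hypotheses (mh : measurable_fun [set: \bar R] h) (h0 : forall r, 0 <= h r).

Lemma le_transition r : (forall r, 0 <= r -> g r <= h r) -> 0 <= r ->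
  transition g r <= transition h r.
Proof.
move=> gh r0; apply: ge0_le_integral => //.
- exact: (measurableT_comp mg).
- exact: (measurableT_comp mh).
- by move=> x _; apply: gh; exact: next_ge0.
Qed.

Lemma transition_antitone r r' :
  (forall r r', 0 <= r -> r <= r' -> g r' <= g r) -> 0 <= r -> r <= r' ->
  transition g r' <= transition g r.
Proof.
move=> ganti r0 rr'; apply: ge0_le_integral => //.
- exact: (measurableT_comp mg).
- exact: (measurableT_comp mg).
- by move=> x _; apply: ganti; [exact: next_ge0|exact: next_mono].
Qed.

Lemma transition_le_cst c r : (forall r, 0 <= r -> g r <= c) -> 0 <= r ->
  transition g r <= c.
Proof.
move=> gc r0; rewrite -[leRHS]mule1 -(probability_setT law) -integral_cst//.
have c0 : 0 <= c by exact: le_trans (g0 0) (gc 0 _).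
apply: ge0_le_integral => //.
- exact: (measurableT_comp mg).
- by move=> x _; apply: gc; exact: next_ge0.
Qed.

Lemma transitionDZ (c : R) r : (0 <= c)%R ->
  transition (fun r => g r + c%:E * h r) r =
  transition g r + c%:E * transition h r.
Proof.
move=> c0; rewrite /transition ge0_integralD//.
- rewrite ge0_integralZl ?lee_fin//.
  exact: (measurableT_comp mh).
- exact: (measurableT_comp mg).
- by move=> x _; rewrite mule_ge0 ?lee_fin.
- by apply: emeasurable_funM => //; exact: (measurableT_comp mh).
Qed.

End Transition.

Lemma transition_lim (g_ : (\bar R -> \bar R)^nat) r :
  (forall n, measurable_fun [set: \bar R] (g_ n)) ->
  (forall n r, 0 <= g_ n r) ->
  (forall r, {homo g_ ^~ r : m n / (m <= n)%N >-> m <= n}) ->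
  transition (fun r => limn (g_ ^~ r)) r =
  limn (fun n => transition (g_ n) r).
Proof.
move=> mg g0 ndg; rewrite /transition.
rewrite -monotone_convergence// => n.
exact: (measurableT_comp (mg n)).
Qed.

Variable A : R.

(** The expected number of steps, among the first [n], before the chain started
    at [r] reaches [A]. *)
Fixpoint survival_time n r : \bar R :=
  if n is m.+1 then
    if 0 <= r < A%:E then 1 + transition (survival_time m) r else 0
  else 0.

(** Value iteration for the problem in which a step from [r] earns [lam] and
    costs [r], stopping is compulsory from [A] on and optional below. Setting
    the gain to 0 for negative [r] makes it monotone in [n] everywhere. *)
Fixpoint gain (lam : R) n r : \bar R :=
  if n is m.+1 then
    if 0 <= r < A%:E then maxe 0 (lam%:E + transition (gain lam m) r - r) else 0
  else 0.

Let measurable_continue :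
  measurable_fun [set: \bar R] (fun r : \bar R => 0 <= r < A%:E).
Proof.
by apply: measurable_and;
  [exact: measurable_fun_lee|exact: measurable_fun_lte].
Qed.

Let continue_fin r : 0 <= r < A%:E -> exists2 x : R, r = x%:E & (0 <= x < A)%R.
Proof.
case: r => [x| |]; rewrite ?ltNge ?leey ?leNye ?andbF//= => x0.
by exists x => //; rewrite -lee_fin ltNge -lee_fin.
Qed.

Let continue_antitone r r' : 0 <= r -> r <= r' -> 0 <= r' < A%:E ->
  0 <= r < A%:E.
Proof. by move=> r0 rr' /andP[_ r'A]; rewrite r0 (le_lt_trans rr'). Qed.

Lemma survival_time_ge0 n r : 0 <= survival_time n r.
Proof.
elim: n r => [//|n IHn] r /=; case: ifP => // _.
by rewrite adde_ge0//; exact: transition_ge0.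
Qed.

Lemma measurable_survival_time n :
  measurable_fun [set: \bar R] (survival_time n).
Proof.
elim: n => [|n IHn]; first exact: measurable_cst.
apply: measurable_fun_ifT => //; apply: emeasurable_funD => //.
by apply: measurable_transition => //; exact: survival_time_ge0.
Qed.

Lemma survival_time_antitone n r r' : 0 <= r -> r <= r' ->
  survival_time n r' <= survival_time n r.
Proof.
elim: n r r' => [//|n IHn] r r' r0 rr' /=; case: ifPn => [r'A|_].
  rewrite (continue_antitone r0 rr' r'A) leeD2l//.
  apply: transition_antitone => //.
  - exact: measurable_survival_time.
  - exact: survival_time_ge0.
by have := survival_time_ge0 n.+1 r.
Qed.

Lemma gain_ge0 lam n r : 0 <= gain lam n r.
Proof. by case: n => //= n; case: ifP => // _; rewrite le_max lexx. Qed.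

Lemma measurable_gain lam n : measurable_fun [set: \bar R] (gain lam n).
Proof.
elim: n => [|n IHn]; first exact: measurable_cst.
apply: measurable_fun_ifT => //; apply: measurable_maxe => //.
apply: emeasurable_funB => //; apply: emeasurable_funD => //.
by apply: measurable_transition => //; exact: gain_ge0.
Qed.

Let mg := measurable_gain.
Let ms := measurable_survival_time.

Lemma gain_antitone lam n r r' : 0 <= r -> r <= r' ->
  gain lam n r' <= gain lam n r.
Proof.
elim: n r r' => [//|n IHn] r r' r0 rr' /=; case: ifPn => [r'A|_].
  rewrite (continue_antitone r0 rr' r'A) le_max2//.
  apply: leeB => //; rewrite leeD2l//; apply: transition_antitone => //.
  exact: gain_ge0.
by have := gain_ge0 lam n.+1 r.
Qed.

Lemma gain_nondecreasing lam r :
  {homo (gain lam ^~ r) : m n / (m <= n)%N >-> m <= n}.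
Proof.
apply/nondecreasing_seqP => n; elim: n r => [|n IHn] r.
  exact: gain_ge0.
rewrite [leLHS]/= [leRHS]/=; case: ifPn => // /andP[r0 _].
rewrite le_max2//; apply: leeB => //; rewrite leeD2l//.
apply: (@le_transition (gain lam n) (gain lam n.+1)) => //; exact: gain_ge0.
Qed.

Lemma gain_le lam lam' n r : (lam <= lam')%R ->
  0 <= r -> gain lam n r <= gain lam' n r.
Proof.
move=> ll'; elim: n r => [//|n IHn] r r0 /=; case: ifP => // _.
rewrite le_max2//; apply: leeB => //; rewrite leeD ?lee_fin//.
by apply: le_transition => //; exact: gain_ge0.
Qed.

(** Raising [lam] raises the reward of each step by the same amount, and the
    number of rewarded steps is at most the survival time. *)
Lemma gain_lipschitz lam lam' n r : (lam <= lam')%R -> 0 <= r ->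
  gain lam' n r <= gain lam n r + (lam' - lam)%:E * survival_time n r.
Proof.
move=> ll'; have l0 : (0 <= lam' - lam)%R by rewrite subr_ge0.
elim: n r => [|n IHn] r r0; first by rewrite /= mule0 adde0.
rewrite /=; case: ifPn => [/continue_fin[x -> x0]|_]; last first.
  by rewrite mule0 adde0.
have Q : transition (gain lam' n) x%:E <= transition (gain lam n) x%:E +
    (lam' - lam)%:E * transition (survival_time n) x%:E.
  rewrite -transitionDZ//; last 2 first.
  - exact: gain_ge0.
  - exact: survival_time_ge0.
  apply: le_transition => //.
  - exact: gain_ge0.
  - apply: emeasurable_funD => //; exact: emeasurable_funM.
  - by case/andP: x0.
rewrite ge_max; apply/andP; split.
  rewrite adde_ge0 ?le_max ?lexx// mule_ge0 ?lee_fin// adde_ge0//.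
  by apply: transition_ge0 => ?; exact: survival_time_ge0.
apply: (@le_trans _ _ ((lam%:E + transition (gain lam n) x%:E - x%:E) +
    (lam' - lam)%:E * (1 + transition (survival_time n) x%:E))).
  rewrite ge0_muleDr ?mule1//; last first.
    by apply: transition_ge0 => ?; exact: survival_time_ge0.
  rewrite [leRHS](_ : _ = lam'%:E + (transition (gain lam n) x%:E +
     (lam' - lam)%:E * transition (survival_time n) x%:E) - x%:E); last first.
    have -> : lam'%:E = lam%:E + (lam' - lam)%:E by rewrite -EFinD subrKC.
    by rewrite [LHS](AC (3*2) ((1*4)*(2*5)*3)).
  by apply: leeB => //; rewrite leeD2l.
by rewrite leeD2r// le_max lexx orbT.
Qed.

Definition optimal_gain lam r := limn (gain lam ^~ r).

Let cvg_gain lam r : gain lam ^~ r @ \oo --> optimal_gain lam r.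
Proof. exact/ereal_nondecreasing_is_cvgn/gain_nondecreasing. Qed.

Let gain_le_optimal lam n r : gain lam n r <= optimal_gain lam r.
Proof.
apply: lime_ge; first exact: cvgP.
by exists n => // m /= nm; exact: gain_nondecreasing.
Qed.

Let optimal_gain_le lam r c :
  (forall n, gain lam n r <= c) -> optimal_gain lam r <= c.
Proof. by move=> gc; apply: lime_le; [exact: cvgP|exact: nearW]. Qed.

Lemma optimal_gain_ge0 lam r : 0 <= optimal_gain lam r.
Proof. exact: le_trans (gain_ge0 lam 0 r) (gain_le_optimal _ _ _). Qed.

Lemma measurable_optimal_gain lam :
  measurable_fun [set: \bar R] (optimal_gain lam).
Proof. by apply: (emeasurable_fun_cvg (gain lam)). Qed.

Let mo := measurable_optimal_gain.

Lemma optimal_gain_stopped lam r : A%:E <= r -> optimal_gain lam r = 0.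
Proof.
move=> Ar; apply/eqP; rewrite eq_le optimal_gain_ge0 andbT.
apply: optimal_gain_le => -[//|n] /=.
by rewrite [r < _]ltNge Ar andbF.
Qed.

Lemma optimal_gain_antitone lam r r' : 0 <= r -> r <= r' ->
  optimal_gain lam r' <= optimal_gain lam r.
Proof.
move=> r0 rr'; apply: optimal_gain_le => n.
exact: le_trans (gain_antitone _ _ r0 rr') (gain_le_optimal _ _ _).
Qed.

Lemma optimal_gain_mono lam lam' r : (lam <= lam')%R -> 0 <= r ->
  optimal_gain lam r <= optimal_gain lam' r.
Proof.
move=> ll' r0; apply: optimal_gain_le => n.
exact: le_trans (gain_le _ ll' r0) (gain_le_optimal _ _ _).
Qed.

Variable B : R.
Hypothesis survival_time_le : forall n, survival_time n 0 <= B%:E.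

Lemma optimal_gain_lipschitz lam lam' r : (lam <= lam')%R -> 0 <= r ->
  optimal_gain lam' r <= optimal_gain lam r + ((lam' - lam) * B)%:E.
Proof.
move=> ll' r0; apply: optimal_gain_le => n.
apply: le_trans (gain_lipschitz _ ll' r0) _.
rewrite leeD ?gain_le_optimal// EFinM lee_wpmul2l ?lee_fin ?subr_ge0//.
exact: le_trans (survival_time_antitone n _ r0) (survival_time_le n).
Qed.

Lemma optimal_gain0 r : 0 <= r -> optimal_gain 0 r = 0.
Proof.
move=> r0; apply/eqP; rewrite eq_le optimal_gain_ge0 andbT.
apply: optimal_gain_le => n; elim: n r r0 => [//|n IHn] r r0 /=.
case: ifP => // _; rewrite ge_max lexx add0e /=.
rewrite (@le_trans _ _ (0 - r))//; last by rewrite add0e oppe_le0.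
apply: leeB => //; apply: transition_le_cst => //; exact: gain_ge0.
Qed.

Lemma optimal_gain_bound lam r : (0 <= lam)%R -> 0 <= r ->
  optimal_gain lam r <= (lam * B)%:E.
Proof.
move=> l0 r0; apply: le_trans (optimal_gain_lipschitz l0 r0) _.
by rewrite optimal_gain0// subr0 add0e.
Qed.

(** The transition of the gain is antitone. Hence, once continuing and stopping
    are equally good at [A], continuing is at least as good below [A], where the
    option to stop is therefore never exercised, and no better above. *)
Lemma optimal_gain_bellman lam : (0 < A)%R ->
  lam%:E + transition (optimal_gain lam) A%:E = A%:E ->
  (forall r, 0 <= r ->
    lam%:E + transition (optimal_gain lam) r <= r + optimal_gain lam r) /\
  (forall r, 0 <= r -> r < A%:E ->
    lam%:E + transition (optimal_gain lam) r = r + optimal_gain lam r).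
Proof.
move=> A0 indiff; have A0' : 0 <= A%:E by rewrite lee_fin ltW.
have transition_lim_gain r : transition (optimal_gain lam) r =
    limn (fun n => transition (gain lam n) r).
  apply: transition_lim => //; first exact: gain_ge0.
  exact: gain_nondecreasing.
have anti r r' : 0 <= r -> r <= r' -> transition (optimal_gain lam) r' <=
    transition (optimal_gain lam) r.
  apply: transition_antitone => //; first exact: optimal_gain_ge0.
  exact: optimal_gain_antitone.
have below r : 0 <= r -> r < A%:E ->
    lam%:E + transition (optimal_gain lam) r <= r + optimal_gain lam r.
  move=> r0 rA; have rA' : 0 <= r < A%:E by rewrite r0.
  have [x rx _] := continue_fin rA'.
  rewrite -leeBrDl// transition_lim_gain; apply: lime_le.
    apply: ereal_nondecreasing_is_cvgn => m n mn.
    apply: le_transition => // [s|s s0]; first exact: gain_ge0.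
    exact: gain_nondecreasing.
  apply: nearW => n; rewrite leeBrDl// addeC.
  have := gain_le_optimal lam n.+1 r; rewrite /= rA' rx.
  rewrite ge_max => /andP[_].
  by rewrite leeBlDr// addeC [in leRHS]addeC.
split=> r r0.
  have [rA|Ar] := ltP r A%:E; first exact: below.
  rewrite optimal_gain_stopped// adde0 (le_trans _ Ar)// -[leRHS]indiff.
  by rewrite leeD2l// anti.
move=> rA; apply/eqP; rewrite eq_le below//=.
have rA' : 0 <= r < A%:E by rewrite r0.
have [x rx _] := continue_fin rA'.
have cont_ge0 : 0 <= lam%:E + transition (optimal_gain lam) r - r.
  rewrite leeBrDr ?rx// add0e -rx (le_trans (ltW rA))// -[leLHS]indiff.
  by rewrite leeD2l// anti// ltW.
rewrite addeC -leeBrDr ?rx// -rx.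
apply: optimal_gain_le => -[|n]; first exact: cont_ge0.
rewrite [leLHS]/= rA' ge_max cont_ge0 /=.
apply: leeB => //; rewrite leeD2l//.
apply: (@le_transition (gain lam n) (optimal_gain lam)) => //.
exact: gain_ge0.
Qed.

(** The net cost of continuing at [A] is [A - lam - transition _ A]. It is
    continuous in [lam] by the Lipschitz bound, equals [A] for [lam = 0] and is
    nonpositive for [lam = A]. *)
Lemma indifference_price : (0 < A)%R -> exists2 lam : R, (0 <= lam)%R &
  lam%:E + transition (optimal_gain lam) A%:E = A%:E.
Proof.
move=> A0; have A0' : 0 <= A%:E by rewrite lee_fin ltW.
have B0 : (0 <= B)%R by rewrite -lee_fin (le_trans _ (survival_time_le 0)).
pose c lam := transition (optimal_gain lam) A%:E.
have c_ge0 lam : 0 <= c lam.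
  by apply: transition_ge0; exact: optimal_gain_ge0.
have cfin lam : (0 <= lam)%R -> c lam \is a fin_num.
  move=> l0; rewrite ge0_fin_numE//.
  apply: (@le_lt_trans _ _ (lam * B)%:E); last by rewrite ltry.
  apply: transition_le_cst => //; first exact: optimal_gain_ge0.
  by move=> r r0; exact: optimal_gain_bound.
have cmono l l' : (l <= l')%R -> c l <= c l'.
  move=> ll'; apply: le_transition => //; first exact: optimal_gain_ge0.
  by move=> r r0; exact: optimal_gain_mono.
have clip l l' : (l <= l')%R -> c l' <= c l + ((l' - l) * B)%:E.
  move=> ll'.
  have -> : ((l' - l) * B)%:E = ((l' - l) * B)%:E * transition (cst 1) A%:E.
    rewrite [X in _ * X](_ : _ = 1) ?mule1// /transition integral_cst// mul1e.
    exact: probability_setT.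
  rewrite -transitionDZ//; last 2 first.
  - exact: optimal_gain_ge0.
  - by rewrite mulr_ge0// subr_ge0.
  apply: le_transition => //; first exact: optimal_gain_ge0.
    by apply: emeasurable_funD => //; exact: measurable_cst.
  by move=> r r0; rewrite mule1; exact: optimal_gain_lipschitz.
have c0 : c 0%R = 0.
  apply/eqP; rewrite eq_le c_ge0 andbT; apply: transition_le_cst => //.
    exact: optimal_gain_ge0.
  by move=> r r0; rewrite optimal_gain0.
have [||||lam /andP[lam0 _] lamE] :=
  @nondecreasing_lipschitz_IVT R (fun x => x + fine (c x))%R 0 A A (1 + B).
- exact: ltW.
- by rewrite addr_ge0.
- move=> x y x0 xy; have y0 := le_trans x0 xy; apply/andP; split.
    by rewrite lerD// fine_le ?cfin// cmono.
  rewrite mulrDr mulr1 addrACA subrKC lerD2l -lee_fin EFinD !fineK ?cfin//.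
  exact: clip.
- by rewrite c0 addr0 ltW//= lerDl fine_ge0.
exists lam => //; rewrite -[X in _ + X]fineK ?cfin//.
by rewrite -EFinD lamE.
Qed.

End OptimalStopping.

(** * Stopping times and delays *)

Section StoppingTimes.
Context d d' (T : measurableType d) (S : measurableType d') (R : realType).
Variable X : nat -> {mfun T >-> S}.
Implicit Types (tau : option nat) (N : T -> option nat).

(** It turns expected delays into series of probabilities of events that depend
    on finitely many observations. *)
Lemma excess_timeE tau k : maxe (time_val R tau - k%:R%:E) 0 =
  \sum_(k <= n <oo) (~~ stopped_by tau n)%:R%:E.
Proof.
pose b tau n : \bar R := (~~ stopped_by tau n)%:R%:E.
have b_ge0 n : 0 <= b tau n by rewrite lee_fin.
have count m : (forall n, (n < m)%N -> ~~ stopped_by tau n) -> (k <= m)%N ->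
    \sum_(k <= n < m) b tau n = (m - k)%:R%:E.
  move=> notyet km; rewrite /b sumEFin (eq_big_nat _ _ (F2 := fun=> 1%R)).
    by rewrite big_const_nat iter_addr_0.
  by move=> n /andP[_ nm]; rewrite notyet.
rewrite -[RHS]/(\sum_(k <= n <oo) b tau n).
case: tau b_ge0 count => [m|] b_ge0 count; rewrite /time_val.
  have [mk|/ltnW km] := leqP m k.
    rewrite max_r; last by rewrite -EFinB lee_fin subr_le0 ler_nat.
    by rewrite eseries0// => n kn _; rewrite /b /= (leq_trans mk kn).
  rewrite max_l; last by rewrite -EFinB lee_fin subr_ge0 ler_nat.
  rewrite (nneseries_split _ (m - k)%N)// subnKC//.
  rewrite [X in _ = _ + X]eseries0 ?adde0.
    by rewrite count ?natrB ?EFinB// => n; rewrite -ltnNge.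
  by move=> n mn _; rewrite /b /= mn.
rewrite addye// max_l ?leey//; apply/esym/eq_infty => r.
apply: le_trans (nneseries_lim_ge (k + (Num.truncn r).+1)%N _) => //.
by rewrite count ?leq_addr// addKn lee_fin ltW// truncnS_gt.
Qed.

Definition running N n : set T := [set w | ~~ stopped_by (N w) n].

Lemma running_obs_filtration N n : is_stopping_time X N ->
  obs_filtration X n (running N n).
Proof.
move=> stN; rewrite (_ : running N n = ~` [set w | stopped_by (N w) n]).
  by apply: (@measurableC _ (obsType X n)); exact: stN.
by apply/seteqP; split=> w /=; move/negP.
Qed.

Lemma measurable_running N n : is_stopping_time X N -> measurable (running N n).
Proof.
move=> stN; apply: (@obs_filtration_measurable _ _ _ _ X n).
exact: running_obs_filtration.
Qed.

Lemma running_decr N m n : (m <= n)%N -> running N n `<=` running N m.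
Proof.
move=> mn w; rewrite /running /=; case: (N w) => //= t; rewrite -!ltnNge.
exact: leq_ltn_trans.
Qed.

Lemma integral_excess_time (P : probability T R) N k : is_stopping_time X N ->
  \int[P]_w maxe (time_val R (N w) - k%:R%:E) 0 =
  \sum_(k <= n <oo) P (running N n).
Proof.
move=> stN.
pose b n w : \bar R := if (k <= n)%N then (\1_(running N n) w)%:E else 0.
have mb n : measurable_fun [set: T] (b n).
  rewrite /b; case: (k <= n)%N => //; apply/measurable_EFinP.
  exact/measurable_indic/measurable_running.
transitivity (\int[P]_w \sum_(n <oo) b n w).
  apply: eq_integral => w _; rewrite excess_timeE eseries_cond eseries_mkcond.
  apply: eq_eseriesr => n _; rewrite /b /=; case: ifP => // _.
  rewrite indicE (_ : (w \in _) = ~~ stopped_by (N w) n)//.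
  by apply/idP/idP; rewrite inE.
rewrite integral_nneseries//; last first.
  by move=> n w _; rewrite /b; case: ifP => // _; rewrite lee_fin.
rewrite [RHS]eseries_cond [RHS]eseries_mkcond; apply: eq_eseriesr => n _ /=.
rewrite /b; case: ifP => // _; last by rewrite integral0.
by rewrite integral_indic ?setIT//; exact: measurable_running.
Qed.

Lemma ARL2FAE (P : probability T R) N : is_stopping_time X N ->
  ARL2FA P N = \sum_(n <oo) P (running N n).
Proof.
move=> stN; rewrite -(integral_excess_time P 0 stN); apply: eq_integral => w _.
by rewrite sube0 max_l//; case: (N w) => //= n; rewrite lee_fin.
Qed.

End StoppingTimes.

(** * The Shiryaev-Roberts statistic *)

Section ShiryaevRoberts.
Context d d' (T : measurableType d) (S : measurableType d') (R : realType).
Variables (mu : {measure set S -> \bar R}) (f0 f1 : S -> R).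
Variables (X : nat -> {mfun T >-> S}).
Variables (P : nat -> probability T R) (Pinf : probability T R).
Hypothesis hmodel : changepoint_model P Pinf X mu f0 f1.

Local Notation L := (likelihood_ratio f0 f1).
Local Notation SR := (SR_stat X f0 f1).
Local Notation law := (distribution Pinf (X 1)).
Local Notation Q := (transition law L).

Let L_ge0 x : 0 <= L x. Proof. exact: (likelihood_ratio_ge0 hmodel). Qed.

Let mL : measurable_fun [set: S] L.
Proof. exact: (measurable_likelihood_ratio hmodel). Qed.

Let lp_ge0 k n w : 0 <= likelihood_product f0 f1 X k n w.
Proof. exact: (likelihood_product_ge0 hmodel). Qed.

Lemma SR_stat0 w : SR 0 w = 0.
Proof. by rewrite /SR_stat big_geq. Qed.

Lemma SR_stat_ge0 n w : 0 <= SR n w.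
Proof. by apply: sume_ge0 => k _; exact: lp_ge0. Qed.

Lemma SR_statS n w : SR n.+1 w = (1 + SR n w) * L (X n.+1 w).
Proof.
rewrite /SR_stat big_nat_recr//= big_nat1 addeC.
rewrite ge0_muleDl ?SR_stat_ge0// mul1e; congr (_ + _).
rewrite ge0_sume_distrl; last by move=> k _; exact: lp_ge0.
by apply: eq_big_nat => k /andP[_ kn]; rewrite big_nat_recr// ltnW.
Qed.

Lemma measurable_SR_stat n :
  measurable_fun [set: obsType X n] (SR n : obsType X n -> \bar R).
Proof.
elim: n => [|n IHn].
  by rewrite (_ : SR 0 = cst 0)//; apply/funext => w; exact: SR_stat0.
rewrite (funext (SR_statS n)); apply: emeasurable_funM.
  by apply: emeasurable_funD => //; exact: (le_obs_measurable_fun (leqnSn n)).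
by apply: (measurable_obs_likelihood_ratio hmodel); rewrite ltnSn.
Qed.

Let mSR n : measurable_fun [set: T] (SR n).
Proof. by apply: obs_measurable_fun; exact: measurable_SR_stat. Qed.

Lemma likelihood_ratio_le_SR i w : (1 <= i)%N -> L (X i w) <= SR i w.
Proof.
case: i => // i _; rewrite SR_statS -[leLHS]mul1e lee_wpmul2r//.
by rewrite leeDl ?SR_stat_ge0.
Qed.

Lemma running_SR_timeE A n w : running (SR_time X f0 f1 A) n w <->
  forall m, (1 <= m <= n)%N -> SR m w < A%:E.
Proof.
rewrite /running /SR_time /=; case: pselect => [ex|nex] /=.
  case: ex_minnP => m /andP[m1 Am] mmin; rewrite -ltnNge; split.
    move=> nm j /andP[j1 jn]; rewrite ltNge; apply/negP => Aj.
    have : (m <= j)%N by apply: mmin; rewrite j1.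
    by rewrite leqNgt (leq_ltn_trans jn).
  move=> small; rewrite ltnNge; apply/negP => mn.
  by move: Am; rewrite leNgt small ?m1.
split=> // _ m /andP[m1 _]; rewrite ltNge; apply/negP => Am.
by apply: nex; exists m; rewrite m1.
Qed.

Lemma SR_time_stopping A : is_stopping_time X (SR_time X f0 f1 A).
Proof.
move=> n; rewrite -obs_measurableE.
rewrite (_ : [set w | _] =
    \bigcup_(m in [set m | 1 <= m <= n]%N) [set w | A%:E <= SR m w]).
  apply: (@bigcup_measurable _ (obsType X n)) => m /andP[m1 mn].
  rewrite -[X in measurable X]setTI; apply: emeasurable_fun_c_infty => //.
  by apply: (le_obs_measurable_fun mn); exact: measurable_SR_stat.
apply/seteqP; split=> w /= => [stop|[m mn Am]].
  apply: contrapT => nstop; have : running (SR_time X f0 f1 A) n w.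
    apply/running_SR_timeE => m mn; rewrite ltNge; apply/negP => Am.
    by apply: nstop; exists m.
  by rewrite /running /= stop.
apply/negPn/negP => /running_SR_timeE /(_ m mn).
by rewrite ltNge Am.
Qed.

(** The Markov property: whether [N] is still running is decided by the first
    [n] observations, and the next one is independent of them. *)
Lemma ge0_integral_next_SR N n (g : \bar R -> \bar R) :
  is_stopping_time X N -> measurable_fun [set: \bar R] g ->
  (forall r, 0 <= g r) ->
  \int[Pinf]_(w in running N n) g (SR n.+1 w) =
  \int[Pinf]_(w in running N n) Q g (SR n w).
Proof.
move=> stN mg g0; pose f (rx : \bar R * S) := g ((1 + rx.1) * L rx.2).
under eq_integral do rewrite SR_statS -[g _]/(f (SR n _, X n.+1 _)).
rewrite (ge0_integral_next_obs (indep_Pinf hmodel)) => [||||rx].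
- apply: eq_integral => w _; apply: eq_measure_integral => A mA _.
  rewrite [LHS](density_Pinf hmodel (isT : (1 <= n.+1)%N) mA).
  by rewrite [RHS](density_Pinf hmodel (isT : (1 <= 1)%N) mA).
- exact: running_obs_filtration.
- exact: measurable_SR_stat.
- by apply: measurableT_comp => //; exact: measurable_next.
- exact: g0.
Qed.

(** The integral delay transported to the law without change. *)
Definition SR_cost N := \sum_(n <oo) \int[Pinf]_(w in running N n) SR n w.

(** The statistic is the sum over [k] of the likelihood products, and all terms
    are nonnegative. *)
Let SR_cost_double_series N : is_stopping_time X N ->
  SR_cost N = \sum_(1 <= k <oo) \sum_(k <= n <oo)
    \int[Pinf]_(w in running N n) likelihood_product f0 f1 X k n w.
Proof.
move=> stN.
pose c k n := \int[Pinf]_(w in running N n) likelihood_product f0 f1 X k n w.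
have c_ge0 k n : 0 <= c k n by exact: integral_ge0.
have mlp k n : measurable_fun [set: T] (likelihood_product f0 f1 X k n).
  rewrite /likelihood_product; elim: (index_iota k n.+1) => [|i s IHs].
    under eq_fun do rewrite big_nil.
    exact: measurable_cst.
  under eq_fun do rewrite big_cons; apply: emeasurable_funM => //.
  exact: measurableT_comp.
transitivity (\sum_(n <oo) \sum_(k <oo | (1 <= k)%N)
    if (k <= n)%N then c k n else 0).
  apply: eq_eseriesr => n _; rewrite /SR_stat ge0_integral_sum//; last first.
  - by move=> k w _; exact: lp_ge0.
  - by move=> k; apply: measurable_funTS; exact: mlp.
  - exact: measurable_running.
  transitivity (\sum_(1 <= k <oo) if (k <= n)%N then c k n else 0); last first.
    by rewrite eseries_cond.
  rewrite (nneseries_split _ n)//; last first.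
    by move=> k _; case: ifP.
  rewrite add1n [X in _ = _ + X]eseries0 ?adde0//; last first.
    by move=> k nk _; rewrite leqNgt nk.
  by apply: eq_big_nat => k /andP[_ kn]; rewrite -ltnS kn.
rewrite nneseries_interchange; last by move=> i j; case: ifP.
rewrite [RHS]eseries_cond; apply: eq_eseriesr => k k1.
by rewrite [RHS]eseries_cond [RHS]eseries_mkcond.
Qed.

Lemma SR_cost_le_integral_delay N : is_stopping_time X N ->
  SR_cost N <= integral_delay P N.
Proof.
move=> stN; rewrite SR_cost_double_series// /integral_delay.
rewrite [leLHS]eseries_cond [leRHS]eseries_cond.
apply: lee_nneseries => [k _ _|k k1].
  by apply: nneseries_ge0 => n _ _; exact: integral_ge0.
rewrite (integral_excess_time _ _ stN); apply: lee_nneseries => [n _ _|n _].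
  exact: integral_ge0.
apply: (integral_likelihood_product_le hmodel) => //.
exact: running_obs_filtration.
Qed.

(** An observation that is impossible before the change has an infinite ratio
    and stops the rule at once. While the rule runs, the change of measure is
    therefore exact. *)
Lemma SR_cost_SR_time A :
  SR_cost (SR_time X f0 f1 A) = integral_delay P (SR_time X f0 f1 A).
Proof.
have stN := SR_time_stopping A.
rewrite SR_cost_double_series// /integral_delay.
rewrite [LHS]eseries_cond [RHS]eseries_cond; apply: eq_eseriesr => k k1.
rewrite (integral_excess_time _ _ stN); apply: eq_eseriesr => n _.
apply: (integral_likelihood_product_eq hmodel) => //.
  exact: running_obs_filtration.
move=> w i /running_SR_timeE run /andP[ki kn].
have i1 : (1 <= i)%N := leq_trans k1 ki.
apply: le_lt_trans (likelihood_ratio_le_SR w i1) _.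
by apply: (lt_trans (run i _)); rewrite ?i1// ltry.
Qed.

Section Threshold.
Variable A : R.
Hypothesis A_gt0 : (0 < A)%R.

Local Notation NA := (SR_time X f0 f1 A).

Lemma running_SR_time_lt n w : running NA n w -> SR n w < A%:E.
Proof.
case: n => [_|n /running_SR_timeE]; first by rewrite SR_stat0 lte_fin.
by apply; rewrite ltnSn.
Qed.

Lemma running_SR_time0 : running NA 0 = [set: T].
Proof.
apply/seteqP; split=> // w _; apply/running_SR_timeE => m.
by case: m.
Qed.

(** The two events differ only where the statistic has just passed [A], and
    there [g] vanishes. *)
Lemma integral_running_SRS (g : \bar R -> \bar R) n :
  (forall r, A%:E <= r -> g r = 0) ->
  \int[Pinf]_(w in running NA n.+1) g (SR n.+1 w) =
  \int[Pinf]_(w in running NA n) g (SR n.+1 w).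
Proof.
move=> g_stopped; rewrite integral_mkcond [RHS]integral_mkcond.
apply: eq_integral => w _.
rewrite !patchE; case: ifPn => [/set_mem run|nrun].
  by rewrite ifT//; apply/mem_set; exact: running_decr run.
case: ifPn => // /set_mem /running_SR_timeE run.
rewrite g_stopped// leNgt; apply/negP => small; move/negP: nrun; apply.
apply/mem_set/running_SR_timeE => m /andP[m1].
rewrite leq_eqVlt => /predU1P[->//|]; rewrite ltnS => mn.
by apply: run; rewrite m1.
Qed.

End Threshold.

(** * Optimality of the Shiryaev-Roberts rule *)

Section Verification.
Variables (lam A : R) (g : \bar R -> \bar R).
Hypothesis lam_ge0 : (0 <= lam)%R.
Hypothesis mg : measurable_fun [set: \bar R] g.
Hypothesis g_ge0 : forall r, 0 <= g r.

Let p N n := Pinf (running N n).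
Let a N n := \int[Pinf]_(w in running N n) g (SR n w).
Let c N n := \int[Pinf]_(w in running N n) SR n w.

Let p_ge0 N n : 0 <= p N n. Proof. exact: measure_ge0. Qed.
Let a_ge0 N n : 0 <= a N n. Proof. by apply: integral_ge0 => w _. Qed.
Let c_ge0 N n : 0 <= c N n.
Proof. by apply: integral_ge0 => w _; exact: SR_stat_ge0. Qed.

Let mrun N n (h : \bar R -> \bar R) : measurable_fun [set: \bar R] h ->
  measurable_fun (running N n) (fun w => h (SR n w)).
Proof. by move=> mh; apply: measurable_funTS; exact: measurableT_comp. Qed.

Let mQg : measurable_fun [set: \bar R] (Q g).
Proof. exact: measurable_transition. Qed.

Let Qg_ge0 r : 0 <= Q g r. Proof. exact: transition_ge0. Qed.

Lemma price_step N n : is_stopping_time X N ->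
  \int[Pinf]_(w in running N n) (lam%:E + Q g (SR n w)) =
  lam%:E * Pinf (running N n) + \int[Pinf]_(w in running N n) g (SR n.+1 w).
Proof.
move=> stN; have mN := measurable_running n stN.
rewrite ge0_integral_next_SR// ge0_integralD//.
- by rewrite integral_cst.
- exact: mrun.
Qed.

Let cost_step N n : is_stopping_time X N ->
  \int[Pinf]_(w in running N n) (SR n w + g (SR n w)) = c N n + a N n.
Proof.
move=> stN; have mN := measurable_running n stN.
rewrite ge0_integralD//.
- by move=> w _; exact: SR_stat_ge0.
- exact: measurable_funTS.
- exact: mrun.
Qed.

(** Each step of a running rule pays the statistic and earns [lam]. The gain [g]
    that remains available, minus the net payments made so far, has
    nonincreasing expectation; it starts at most at [g 0], and [g] is
    nonnegative. *)
Lemma price_le_SR_cost N : is_stopping_time X N ->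
  (forall r, 0 <= r -> lam%:E + Q g r <= r + g r) ->
  lam%:E * ARL2FA Pinf N <= SR_cost N + g 0.
Proof.
move=> stN bellman; rewrite (ARL2FAE _ stN).
have step n : lam%:E * p N n + a N n.+1 <= c N n + a N n.
  rewrite -cost_step//; have mN := measurable_running n stN.
  apply: (@le_trans _ _ (lam%:E * p N n +
      \int[Pinf]_(w in running N n) g (SR n.+1 w))).
    rewrite leeD2l//; apply: ge0_subset_integral => //.
    - exact: measurable_running.
    - by apply: measurable_funTS; exact: measurableT_comp.
    - exact: running_decr.
  rewrite -price_step//; apply: ge0_le_integral => //.
  - by move=> w _; rewrite adde_ge0.
  - by apply: emeasurable_funD => //; exact: mrun.
  - apply: emeasurable_funD; [exact: measurable_funTS|exact: mrun].
  - by move=> w _; apply: bellman; exact: SR_stat_ge0.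
have sums m : \sum_(0 <= n < m) (lam%:E * p N n) + a N m <=
    \sum_(0 <= n < m) c N n + a N 0.
  elim: m => [|m IHm]; first by rewrite !big_geq.
  rewrite !big_nat_recr//= -addeA.
  apply: le_trans (leeD2l _ (step m)) _.
  by rewrite addeCA [leRHS]addeAC [leRHS]addeC leeD2l.
have a0 : a N 0 <= g 0.
  rewrite /a; under eq_integral do rewrite SR_stat0.
  rewrite integral_cst; last exact: measurable_running.
  rewrite -[leRHS]mule1 lee_wpmul2l//.
  by apply: probability_le1; exact: measurable_running.
rewrite -nneseriesZl//; apply: lime_le.
  by apply: is_cvg_nneseries => n _ _; rewrite mule_ge0 ?lee_fin.
apply: nearW => m; apply: (@le_trans _ _ (\sum_(0 <= n < m) c N n + a N 0)).
  by apply: le_trans (sums m); rewrite leeDl.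
by rewrite leeD//; exact: nneseries_lim_ge.
Qed.

Hypothesis A_gt0 : (0 < A)%R.
Hypothesis g_stopped : forall r, A%:E <= r -> g r = 0.

Local Notation NA := (SR_time X f0 f1 A).

(** For the Shiryaev-Roberts rule the expectation above is constant, and the
    remaining gain, at most [C] times the probability of still running, tends
    to 0. *)
Lemma SR_cost_le_price (C B : R) :
  (forall r, 0 <= r -> g r <= C%:E) ->
  (forall r, 0 <= r -> r < A%:E -> lam%:E + Q g r = r + g r) ->
  ARL2FA Pinf NA = B%:E ->
  SR_cost NA + g 0 <= lam%:E * ARL2FA Pinf NA.
Proof.
move=> gC bellman arl; have stN := SR_time_stopping A.
have C0 : (0 <= C)%R by rewrite -lee_fin (le_trans (g_ge0 0)) ?gC.
have step n : lam%:E * p NA n + a NA n.+1 = c NA n + a NA n.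
  rewrite -cost_step// /a integral_running_SRS// -price_step//.
  apply: eq_integral => w /set_mem run; apply: bellman.
    exact: SR_stat_ge0.
  exact: running_SR_time_lt.
have sums m : \sum_(0 <= n < m) (lam%:E * p NA n) + a NA m =
    \sum_(0 <= n < m) c NA n + a NA 0.
  elim: m => [|m IHm]; first by rewrite !big_geq.
  rewrite !big_nat_recr//= -addeA step.
  by rewrite addeCA IHm addeCA addeA.
have a0 : a NA 0 = g 0.
  rewrite /a; under eq_integral do rewrite SR_stat0.
  rewrite integral_cst running_SR_time0// [X in _ * X](_ : _ = 1) ?mule1//.
  exact: probability_setT.
have ap m : a NA m <= C%:E * p NA m.
  rewrite -integral_cst; last exact: measurable_running.
  apply: ge0_le_integral => //.
  - exact: measurable_running.
  - exact: mrun.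
  - by move=> w _; apply: gC; exact: SR_stat_ge0.
have psum : \sum_(n <oo) p NA n = B%:E by rewrite -arl (ARL2FAE _ stN).
have p0 : p NA m @[m --> \oo] --> 0.
  apply: (@squeeze_cvge _ _ _ _ (fun=> 0) _
    (fun m => \sum_(m <= n <oo) p NA n)).
  - apply: nearW => m; rewrite p_ge0/=.
    rewrite (nneseries_split _ 1)// addn1 big_nat1.
    by rewrite leeDl//; apply: nneseries_ge0.
  - exact: cvg_cst.
  - by apply: nneseries_tail_cvg => //; rewrite psum ltry.
have bound m : \sum_(0 <= n < m) c NA n + g 0 <= lam%:E * B%:E + C%:E * p NA m.
  rewrite -a0 -sums leeD// -psum -nneseriesZl//.
  by apply: nneseries_lim_ge => n _ _; rewrite mule_ge0 ?lee_fin.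
have bound_cvg : lam%:E * B%:E + C%:E * p NA m @[m --> \oo] --> lam%:E * B%:E.
  rewrite -[X in _ --> X]adde0 -(mule0 C%:E).
  by apply: cvgeD => //; [exact: cvg_cst|exact: cvgeZl].
have g0_fin : g 0 \is a fin_num.
  by rewrite ge0_fin_numE// (le_lt_trans (gC 0 _))// ltry.
rewrite arl -leeBrDr//; apply: lime_le.
  by apply: is_cvg_nneseries => n _ _; exact: c_ge0.
apply: nearW => k; rewrite leeBrDr// -(cvg_lim _ bound_cvg)//.
apply: lime_ge; first exact: cvgP bound_cvg.
exists k => // m /= km; apply: le_trans (bound m); rewrite leeD2r//.
by apply: lee_sum_nneg_natr => // n _ _; exact: c_ge0.
Qed.

End Verification.

(** The truncated survival time is the mean of the alarm time truncated in the
    same way. *)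
Lemma survival_time_le_ARL2FA A m : (0 < A)%R ->
  survival_time law L A m 0 <= ARL2FA Pinf (SR_time X f0 f1 A).
Proof.
move=> A0; have stN := SR_time_stopping A.
set N := SR_time X f0 f1 A in stN *; pose s := survival_time law L A.
have s_ge0 k r : 0 <= s k r by exact: survival_time_ge0.
have ms k : measurable_fun [set: \bar R] (s k).
  exact: measurable_survival_time.
have truncated k n : \int[Pinf]_(w in running N n) s k (SR n w) =
    \sum_(n <= j < k + n) Pinf (running N j).
  elim: k n => [|k IHk] n; first by rewrite big_geq// integral0.
  rewrite addSnnS big_ltn ?leq_addl// -IHk integral_running_SRS//; last first.
    by move=> r Ar; rewrite /s; case: (k) => //= j; rewrite ltNge Ar andbF.
  rewrite -[X in X + _]mul1e -price_step//.
  apply: eq_integral => w /set_mem run.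
  by rewrite /s/= SR_stat_ge0 running_SR_time_lt.
have := truncated m 0%N; under eq_integral do rewrite SR_stat0.
rewrite integral_cst /N running_SR_time0// [X in _ * X](_ : _ = 1); last first.
  exact: probability_setT.
rewrite mule1 => ->; rewrite (ARL2FAE _ stN) addn0.
exact: nneseries_lim_ge.
Qed.

(** With [lam] as a Lagrange multiplier for the constraint on the mean time to
    false alarm, both rules are compared with the same number [g 0]. *)
Lemma SR_time_minimizes_SR_cost A B N : (0 < A)%R ->
  ARL2FA Pinf (SR_time X f0 f1 A) = B%:E -> is_stopping_time X N ->
  B%:E <= ARL2FA Pinf N -> SR_cost (SR_time X f0 f1 A) <= SR_cost N.
Proof.
move=> A0 arl stN BN.
have survB m : survival_time law L A m 0 <= B%:E.
  by rewrite -arl; exact: survival_time_le_ARL2FA.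
have [lam lam0 indiff] := indifference_price mL L_ge0 survB A0.
have [bell_le bell_eq] := optimal_gain_bellman mL L_ge0 A0 indiff.
set g := optimal_gain law L A lam in indiff bell_le bell_eq.
have g_ge0 r : 0 <= g r by exact: optimal_gain_ge0.
have mg : measurable_fun [set: \bar R] g by exact: measurable_optimal_gain.
have gB r : 0 <= r -> g r <= (lam * B)%:E.
  by move=> r0; apply: optimal_gain_bound.
have g_stop r : A%:E <= r -> g r = 0 by exact: optimal_gain_stopped.
have g0_fin : g 0 \is a fin_num.
  by rewrite ge0_fin_numE// (le_lt_trans (gB 0 _))// ltry.
rewrite -(leeD2rE _ _ g0_fin).
apply: le_trans (SR_cost_le_price lam0 mg g_ge0 A0 g_stop gB bell_eq arl) _.
apply: le_trans (price_le_SR_cost lam0 mg g_ge0 stN bell_le).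
by rewrite lee_wpmul2l ?lee_fin// arl.
Qed.

Lemma SR_cost_ge0 N : 0 <= SR_cost N.
Proof.
apply: nneseries_ge0 => n _ _; apply: integral_ge0 => w _.
exact: SR_stat_ge0.
Qed.

(** Such a rule always stops at the first observation, since the statistic is
    nonnegative. *)
Lemma SR_cost_threshold_le0 A : (A <= 0)%R -> SR_cost (SR_time X f0 f1 A) = 0.
Proof.
move=> A0; apply: eseries0 => -[_ _|n _ _].
  by rewrite integral0_eq// => w _; rewrite SR_stat0.
rewrite (_ : running _ _ = set0) ?integral_set0//.
apply/seteqP; split=> // w /running_SR_timeE /(_ 1%N isT).
by rewrite ltNge (@le_trans _ _ 0) ?SR_stat_ge0 ?lee_fin.
Qed.

End ShiryaevRoberts.

Theorem theorem1 (R : realType) (d d' : measure_display)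
    (T : measurableType d) (S : measurableType d')
    (mu : {measure set S -> \bar R}) (f0 f1 : S -> R)
    (X : nat -> {mfun T >-> S})
    (P : nat -> probability T R) (Pinf : probability T R)
    (hmodel : changepoint_model P Pinf X mu f0 f1)
    (B A : R) (hB : (0 < B)%R)
    (hA : ARL2FA Pinf (SR_time X f0 f1 A) = B%:E) :
  Delta X Pinf B (SR_time X f0 f1 A) /\
  ereal_inf [set integral_delay P N | N in Delta X Pinf B] =
    integral_delay P (SR_time X f0 f1 A).
Proof.
have SRDelta : Delta X Pinf B (SR_time X f0 f1 A).
  by split; [exact: (SR_time_stopping hmodel)|rewrite hA].
split=> //; apply/eqP; rewrite eq_le; apply/andP; split.
  by apply: ereal_inf_lbound; exists (SR_time X f0 f1 A).
apply: le_ereal_inf_tmp => _ [N [stN BN] <-].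
apply: le_trans (SR_cost_le_integral_delay hmodel stN).
rewrite -(SR_cost_SR_time hmodel).
have [A0|A0] := ltP 0%R A.
  exact: (SR_time_minimizes_SR_cost hmodel A0 hA stN BN).
by rewrite (SR_cost_threshold_le0 hmodel)// (SR_cost_ge0 hmodel).
Qed.
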